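(* Let $\dot S_n$ be the subgroup of $B_n$ generated by $s_1,\dots,s_{n-1}$, and let $\pi\in\dot S_n$ be a non-identity element. Then, considered as an element of $S_n$, $\pi$ is a standard $OGS$ elementary element if and only if the generalized standard $OGS$ presentation of $\pi$ (as an element of $B_n$) has the form $$\pi=\tau_{k_1}^{i_{k_1}}\cdot\tau_{k_2}^{i_{k_2}}\cdots\tau_{k_m}^{i_{k_m}}$$ with $$-k_1\le i_{k_1}<0,\qquad 0<i_{k_j}<k_j\ \text{ for } j\ge 2,\qquad \sum_{j=1}^m i_{k_j}=0.$$
   Context: $B_n$ is the group of signed permutations, i.e. the bijections $\pi$ of $\{\pm1,\dots,\pm n\}$ with $\pi(-i)=-\pi(i)$. It is a Coxeter group with generators $s_0,\dots,s_{n-1}$, where $s_0$ exchanges $1$ and $-1$, and for $1\le i\le n-1$, $s_i$ exchanges $i$ with $i+1$ and $-i$ with $-(i+1)$. Products are read from left to right: $(\pi_1\cdot\pi_2)(i)=\pi_2(\pi_1(i))$. For $1\le k\le n$, $\tau_k=s_0s_1\cdots s_{k-1}$. Every element of $B_n$ has a unique presentation $\tau_1^{i_1}\cdots\tau_n^{i_n}$ with integers $-k\le i_k<k$, called its generalized standard $OGS$ presentation; omitting trivial factors it is written $\tau_{k_1}^{i_{k_1}}\cdots\tau_{k_m}^{i_{k_m}}$ with $k_1<\dots<k_m$ and all $i_{k_j}\ne0$. $\dot S_n$ is identified with the symmetric group $S_n$ by sending $s_i$ to the transposition $(i,i+1)$ (restriction to $\{1,\dots,n\}$). In $S_n$, for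 $2\le k\le n$ let $t_k=s_1s_2\cdots s_{k-1}$. Every element of $S_n$ has a unique presentation $t_2^{i_2}\cdots t_n^{i_n}$ with $0\le i_k<k$ (the standard $OGS$ canonical form). A non-identity element whose canonical form, after omitting trivial factors, is $\prod_{j=1}^m t_{k_j}^{i_{k_j}}$ with $k_1<\dots<k_m$ and $0<i_{k_j}<k_j$ is called a standard $OGS$ elementary element if $\sum_{j=1}^m i_{k_j}\le k_1$. *)

(* Defs.v *)
From mathcomp Require Import all_boot all_order all_algebra all_fingroup.

Set Implicit Arguments.
Unset Strict Implicit.
Unset Printing Implicit Defensive.

Import Order.TTheory GRing.Theory Num.Theory.
Local Open Scope group_scope.

(* The set {+-1, ..., +-n}: (i, false) stands for i+1, (i, true) for -(i+1). *)
Notation signed n := ('I_n * bool)%type.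

Definition oppl n (x : signed n) : signed n := (x.1, ~~ x.2).

(* MathComp's product of permutations is read from left to right:
   (p * q) x = q (p x), see permM. *)
Definition signed_perms n : {set {perm (signed n)}} :=
  [set p : {perm (signed n)} | [forall x, p (oppl x) == oppl (p x)]].

Lemma signed_permsP n (p : {perm (signed n)}) :
  reflect (forall x, p (oppl x) = oppl (p x)) (p \in signed_perms n).
Proof. by rewrite inE; apply: (iffP forallP) => h x; apply/eqP. Qed.

Lemma signed_perms_group_set n : group_set (signed_perms n).
Proof.
apply/group_setP; split; first by apply/signed_permsP => x; rewrite !perm1.
move=> p q /signed_permsP hp /signed_permsP hq.
by apply/signed_permsP => x; rewrite !permM hp hq.
Qed.

Canonical signed_perms_group n := Group (signed_perms_group_set n).

Definition prev_ord n (i : 'I_n) : 'I_n :=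
  Ordinal (leq_ltn_trans (leq_pred i) (ltn_ord i)).

(* As ordinals are 0-based, for 0 < i < n the letters i and i+1 are the
   ordinals i-1 and i. *)
Definition sgen n (i : 'I_n) : {perm (signed n)} :=
  if i == 0 :> nat then tperm (i, false) (i, true)
  else tperm (prev_ord i, false) (i, false) * tperm (prev_ord i, true) (i, true).

(* s_0 s_1 ... s_(k-1), for 1 <= k <= n *)
Definition tau n (k : nat) : {perm (signed n)} := \prod_(i < n | i < k) sgen i.

Definition dotS n : {group {perm (signed n)}} :=
  <<[set sgen i | i : 'I_n & 0 < i]>>%G.

Lemma prev_ord_neq n (i : 'I_n) : 0 < i -> prev_ord i != i.
Proof. by move=> i0; rewrite -val_eqE /= neq_ltn prednK ?leqnn. Qed.

Lemma sgenE n (i : 'I_n) (x : signed n) : 0 < i ->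
  sgen i x = (tperm (prev_ord i) i x.1, x.2).
Proof.
move=> i0; have pi := prev_ord_neq i0.
rewrite /sgen eqn0Ngt i0 /= permM; case: x => j b /=.
have D (a c k : 'I_n) u v : u != v ->
    tperm (a, u) (c, u) (k, v) = (k, v) :> signed n.
  by move=> uv; rewrite tpermD // xpair_eqE (negPf uv) andbF.
have E (a c k : 'I_n) u :
    tperm (a, u) (c, u) (k, u) = (tperm a c k, u) :> signed n.
  case: (tpermP a c k) => [->|->|ka kc]; rewrite ?tpermL ?tpermR //.
  by rewrite tpermD //; apply/eqP => -[]; [move/esym/ka|move/esym/kc].
by case: b; [rewrite D ?E|rewrite E ?D].
Qed.

Lemma sgen_signed n (i : 'I_n) : sgen i \in signed_perms n.
Proof.
have [i0|i0] := posnP i; apply/signed_permsP => -[j b]; last by rewrite !sgenE.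
rewrite /sgen i0 /oppl /=.
have [<-|ne] := eqVneq i j; first by case: b; rewrite ?tpermL ?tpermR.
by rewrite !tpermD // xpair_eqE (negPf ne).
Qed.

Lemma dotS_sub n : dotS n \subset signed_perms n.
Proof.
rewrite gen_subG; apply/subsetP => _ /imsetP [i _ ->]; exact: sgen_signed.
Qed.

(* The identification of dotS n with the symmetric group, by restriction to
   {1, ..., n}. The map i |-> |p i| is injective for every p in signed_perms n,
   so the default value 1 is not used there; see restrE and restr_sgen. *)
Definition restr n (p : {perm (signed n)}) : 'S_n :=
  insubd (1 : 'S_n) [ffun i => (p (i, false)).1].

Lemma restr_val n (p : {perm (signed n)}) i :
  p \in signed_perms n -> restr p i = (p (i, false)).1.
Proof.
move=> /signed_permsP hp; rewrite /restr.
have inj : injectiveb [ffun i => (p (i, false)).1].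
  apply/injectiveP => j k; rewrite !ffunE.
  case Ej: (p (j, false)) => [a b]; case Ek: (p (k, false)) => [c d] /= Eac.
  have [Ebd|nbd] := eqVneq b d.
    have : p (j, false) = p (k, false) by rewrite Ej Ek Eac Ebd.
    by move/perm_inj => -[].
  have : p (j, false) = p (oppl (k, false)).
    by rewrite hp Ej Ek Eac /oppl /=; case: b d nbd {Ej Ek} => -[].
  by move/perm_inj => -[].
by rewrite -pvalE val_insubd inj ffunE.
Qed.

Lemma restrE n (p : {perm (signed n)}) i :
  p \in dotS n -> p (i, false) = (restr p i, false).
Proof.
move=> hp; have hs : p \in signed_perms n by apply: (subsetP (dotS_sub n)).
rewrite restr_val //; suff : (p (i, false)).2 = false by case: (p _) => a b /= ->.
have [m [c hc ->]] := gen_prodgP hp.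
elim: m c hc i {hp hs} => [|m IH] c hc i; first by rewrite big_ord0 perm1.
rewrite big_ord_recl permM; have /imsetP [j] := hc ord0; rewrite inE => j0 ->.
by rewrite sgenE //=; apply: IH => k; apply: hc.
Qed.

Lemma restr_sgen n (i : 'I_n) :
  0 < i -> restr (sgen i) = tperm (prev_ord i) i.
Proof.
by move=> i0; apply/permP => j; rewrite restr_val ?sgen_signed // sgenE.
Qed.

(* s_1 s_2 ... s_(k-1) in S_n, for 2 <= k <= n *)
Definition tcyc n (k : nat) : 'S_n :=
  \prod_(i < n | 0 < i < k) tperm (prev_ord i) i.

(* A presentation with its trivial factors omitted is the list of the pairs
   (k_j, i_(k_j)), in increasing order of the k_j. *)
Definition std_OGS n (p : 'S_n) (w : seq (nat * nat)) : Prop :=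
  [/\ sorted ltn (unzip1 w),
      forall x, x \in w -> 2 <= x.1 <= n /\ 0 < x.2 < x.1
    & p = \prod_(x <- w) tcyc n x.1 ^+ x.2].

Definition std_OGS_elementary n (p : 'S_n) : Prop :=
  p <> 1 /\ exists k1 i1 w,
    std_OGS p ((k1, i1) :: w) /\ i1 + \sum_(x <- w) x.2 <= k1.

Definition expgz (gT : finGroupType) (x : gT) (i : int) : gT :=
  match i with Posz m => x ^+ m | Negz m => x ^- m.+1 end.

Definition gen_std_OGS n (p : {perm (signed n)}) (w : seq (nat * int)) : Prop :=
  [/\ sorted ltn (unzip1 w),
      forall x, x \in w ->
        [/\ 1 <= x.1 <= n, (- x.1%:Z <= x.2 < x.1%:Z)%R & x.2 <> 0%R]
    & p = \prod_(x <- w) expgz (tau n x.1) x.2].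

(* Main.v *)
(** Write t_k for tcyc and tau_k for tau.  Forgetting signs sends tau_k to t_k,
    and tau_k ^+ i changes the sign of exactly those letters x <= i which it
    wraps around to x + k - i.  If the exponents of prod_j t_(k_j)^(i_j) sum to
    S and S <= k_j for all j, then in prod_j tau_(k_j)^(i_j) the letters 1..S
    are wrapped around exactly once and the others never.  As tau_S ^+ S
    changes the signs of 1..S, the element of dotS n lying over
    prod_j t_(k_j)^(i_j) is tau_S^S prod_j tau_(k_j)^(i_j), where
    tau_S^S = tau_S^(-S); when S = k_1 the first two factors merge. *)
Require Import Defs.
From mathcomp Require Import all_boot all_order all_algebra all_fingroup.
From mathcomp Require Import zify.

Set Implicit Arguments.
Unset Strict Implicit.
Unset Printing Implicit Defensive.

Import Order.TTheory GRing.Theory Num.Theory.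

(** * Signed permutations and the homomorphism [restr] that forgets signs *)

Section SignedPermutations.

Local Open Scope group_scope.

Variable n : nat.

Implicit Types (p q : {perm (signed n)}) (i x : 'I_n) (b : bool) (k m : nat).

Lemma signed_perm_addb p x b : p \in signed_perms n ->
  p (x, b) = ((p (x, false)).1, b (+) (p (x, false)).2).
Proof.
move=> /signed_permsP hp; case: b => /=; last by case: (p _).
by rewrite -[(x, true)]/(oppl (x, false)) hp.
Qed.

Lemma restrM : {in signed_perms n &, {morph @restr n : p q / p * q}}.
Proof.
move=> p q hp hq; apply/permP => x.
rewrite permM !restr_val ?groupM // permM.
by case: (p (x, false)) => y b; rewrite signed_perm_addb.
Qed.

Canonical restr_morphism := Morphism restrM.

Lemma signed_perm_inj p q : p \in signed_perms n -> q \in signed_perms n ->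
  restr p = restr q -> (forall x, (p (x, false)).2 = (q (x, false)).2) -> p = q.
Proof.
move=> hp hq epq s; apply/permP => -[x b].
rewrite signed_perm_addb // [q _]signed_perm_addb // s.
by rewrite -!restr_val // epq.
Qed.

(** Needed to pass from [p <> 1] to [restr p <> 1], the first half of being elementary. *)
Lemma restr_dotS_inj : {in dotS n, forall p, restr p = 1 -> p = 1}.
Proof.
move=> p hp r1; apply/permP => -[x b].
by rewrite signed_perm_addb ?(subsetP (dotS_sub n)) // restrE // r1 !perm1 addbF.
Qed.

Lemma restr_sgen0 i : i = 0 :> nat -> restr (sgen i) = 1.
Proof.
move=> i0; apply/permP => x; rewrite restr_val ?sgen_signed // perm1.
rewrite /sgen i0 /=; have [<-|ne] := eqVneq i x; first by rewrite tpermL.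
by rewrite tpermD // xpair_eqE (negPf ne).
Qed.

(** * Powers of [tau n k] and their action on letters and signs *)

Lemma tau_signed k : tau n k \in signed_perms n.
Proof. by apply: group_prod => i _; apply: sgen_signed. Qed.

Lemma restr_tau k : restr (tau n k) = tcyc n k.
Proof.
rewrite (morph_prod restr_morphism) => [|i _]; last exact: sgen_signed.
rewrite /tcyc [RHS]big_mkcondl; apply: eq_bigr => i _ /=.
by case: posnP => i0; [rewrite restr_sgen0 | rewrite restr_sgen].
Qed.

Lemma tau0 : tau n 0 = 1.
Proof. by rewrite /tau big1. Qed.

Lemma tauS k (kn : k < n) : tau n k.+1 = tau n k * sgen (Ordinal kn).
Proof.
(* Extending the generators by 1 to all of [nat] makes the product nat-indexed, so that its last
   factor splits off. *)
pose F m : {perm (signed n)} := if insub m is Some i then sgen i else 1.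
have E m : m <= n -> tau n m = \prod_(0 <= j < m) F j.
  move=> mn; rewrite big_mkord (big_ord_widen n F mn).
  by apply: eq_bigr => i _; rewrite /F valK.
rewrite !E ?(ltnW kn) // big_nat_recr //=; congr (_ * _).
by rewrite /F insubT.
Qed.

Lemma tauE k x b : k <= n ->
  let y := tau n k (x, b) in
  (y.1 : nat, y.2) =
    if x < k then if x == 0 :> nat then (k.-1, ~~ b) else (x.-1, b)
    else (x : nat, b).
Proof.
elim: k => [|k IH] kn /=; first by rewrite tau0 perm1.
have {IH} := IH (ltnW kn); rewrite (tauS kn) permM /=.
have : Ordinal kn = k :> nat by [].
move: (Ordinal kn) => K eK; case: (tau n k _) => y c /=.
have [k0|k0] := posnP k.
  rewrite k0 in eK *; move=> /= [exy ->]; rewrite /sgen eK /=.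
  have [x0|x0] := posnP x.
    have -> : y = K by apply: val_inj; rewrite /= exy x0 eK.
    by case: b; rewrite /= ?tpermR ?tpermL /= eK x0.
  have yK : K != y by rewrite -val_eqE /= eK exy eq_sym -lt0n.
  by rewrite !tpermD ?xpair_eqE ?(negPf yK) //= exy ltnS leqNgt x0.
rewrite sgenE ?eK //=.
have -> : tperm (prev_ord K) K y =
   (if y == k.-1 :> nat then k else if y == k :> nat then k.-1 else y) :> nat.
  by case: tpermP => [->|->|/eqP+ /eqP+]; rewrite -?val_eqE /= ?eK;
    do ?case: eqP; lia.
by case: (ltnP x k) => ?; case: (ltnP x k.+1) => ?; case: (x =P 0 :> nat) => ?;
  move=> [-> ->]; congr (_, _); do ?case: eqP; lia.
Qed.

(** After [m < k] steps only the 0-based letter [m] sits at 0, so it alone is wrapped by the next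
    factor. A letter wrapped earlier sits at [x + k - m >= 1] and is not wrapped again. *)
Lemma tau_expE k m x b : k <= n -> m <= k ->
  let y := (tau n k ^+ m) (x, b) in
  (y.1 : nat, y.2) =
    if x < k then if x < m then (x + k - m, ~~ b) else (x - m, b)
    else (x : nat, b).
Proof.
move=> kn; elim: m => [|m IH] mk /=.
  by rewrite expg0 perm1 subn0; case: ifP.
have := IH (ltnW mk); rewrite expgSr permM /=.
case: ((tau n k ^+ m) _) => y c /= eyc; rewrite (tauE y c kn); move: eyc.
by case: (ltnP x k) => ?; case: (ltnP x m) => ?; case: (ltnP x m.+1) => ? [-> ->];
  do ?case: ifP; move=> *; congr (_, _); lia.
Qed.

Lemma tau_expk k x b : k <= n -> (tau n k ^+ k) (x, b) = (x, (x < k) (+) b).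
Proof.
move=> kn; have := tau_expE x b kn (leqnn k).
case: ((tau n k ^+ k) _) => y c /= e.
have [ey ->] : y = x :> nat /\ c = (x < k) (+) b.
  by move: e; case: ltnP => ? [-> ->]; rewrite ?addnK.
by congr (_, _); apply: val_inj.
Qed.

(** [tau n k ^+ k] flips the signs of the first [k] letters, so it is an involution and [tau n k]
    has [2k]-th power 1. *)
Lemma tau_expNn k m : k <= n -> m <= k ->
  tau n k ^- m = tau n k ^+ k * tau n k ^+ (k - m).
Proof.
move=> kn mk; apply: (mulIg (tau n k ^+ m)).
rewrite mulVg -mulgA -expgD subnK //; apply/permP => -[x b].
by rewrite permM !tau_expk // addKb perm1.
Qed.

Lemma tcyc_expk k : k <= n -> tcyc n k ^+ k = 1.
Proof.
move=> kn; rewrite -restr_tau -(morphX restr_morphism) ?tau_signed //=.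
apply/permP => x.
by rewrite restr_val ?groupX ?tau_signed // tau_expk // perm1.
Qed.

(** * Lifting products of the [tcyc n k] to [dotS n] *)

Lemma prod_tau_signed (w : seq (nat * nat)) :
  \prod_(y <- w) tau n y.1 ^+ y.2 \in signed_perms n.
Proof. by apply: group_prod => y _; rewrite groupX ?tau_signed. Qed.

Lemma restr_prod_tau (w : seq (nat * nat)) :
  restr (\prod_(y <- w) tau n y.1 ^+ y.2) = \prod_(y <- w) tcyc n y.1 ^+ y.2.
Proof.
rewrite (morph_prod restr_morphism) => [|y _]; last by rewrite groupX ?tau_signed.
apply: eq_bigr => y _.
by rewrite (morphX restr_morphism) ?tau_signed //= restr_tau.
Qed.

Lemma restr_tau_lift S (w : seq (nat * nat)) : S <= n ->
  restr (tau n S ^+ S * \prod_(y <- w) tau n y.1 ^+ y.2) =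
  \prod_(y <- w) tcyc n y.1 ^+ y.2.
Proof.
move=> Sn; rewrite restrM ?groupX ?tau_signed ?prod_tau_signed //.
rewrite restr_prod_tau (morphX restr_morphism) ?tau_signed //=.
by rewrite restr_tau tcyc_expk // mul1g.
Qed.

(** The starting sign [x < S] is the one left by [tau n S ^+ S]. Each factor preserves the invariant
    that the letter at [y] is negative iff [y] is below the sum of the remaining exponents. *)
Lemma prod_tau_sign (w : seq (nat * nat)) x :
    (forall y, y \in w -> \sum_(z <- w) z.2 <= y.1 <= n) ->
  ((\prod_(y <- w) tau n y.1 ^+ y.2) (x, x < \sum_(z <- w) z.2)).2 = false.
Proof.
elim: w x => [|[k m] w IH] x hw; first by rewrite !big_nil perm1.
rewrite !big_cons permM /=; rewrite big_cons /= in hw.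
set S := \sum_(z <- w) z.2 in IH hw *.
have /andP[Sk kn] : m + S <= k <= n by apply: (hw (k, m)); rewrite mem_head.
have hw' y : y \in w -> S <= y.1 <= n.
  move=> yw; have /andP[h ->] : m + S <= y.1 <= n by apply: hw; rewrite inE yw orbT.
  by rewrite (leq_trans (leq_addl m S)).
have mk : m <= k by lia.
have := tau_expE x (x < m + S) kn mk; case: ((tau n k ^+ m) _) => y c /= e.
suff -> : c = (y < S) by apply: IH.
(* Letters [x < m] turn positive and land at [x + k - m >= S]; those in [[m, k)] keep their sign and
   shift by [m]; those from [k] on are fixed and positive, as [m + S <= k]. *)
by move: e; case: (ltnP x k) => ?; case: (ltnP x m) => ? [-> ->]; lia.
Qed.

Lemma dotS_tau_lift p (w : seq (nat * nat)) (S := \sum_(y <- w) y.2) :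
    p \in dotS n -> S <= n -> (forall y, y \in w -> S <= y.1 <= n) ->
    restr p = \prod_(y <- w) tcyc n y.1 ^+ y.2 ->
  p = tau n S ^+ S * \prod_(y <- w) tau n y.1 ^+ y.2.
Proof.
move=> pS Sn hw rp; apply: signed_perm_inj.
- exact: (subsetP (dotS_sub n)).
- by rewrite groupM ?groupX ?tau_signed ?prod_tau_signed.
- by rewrite restr_tau_lift.
by move=> x; rewrite restrE // permM tau_expk // addbF prod_tau_sign.
Qed.

End SignedPermutations.

(** * Integer exponents and the equivalence *)

Local Open Scope ring_scope.

Definition posz_exps (w : seq (nat * nat)) : seq (nat * int) :=
  [seq (x.1, x.2%:Z) | x <- w].

Lemma posz_expsK (w : seq (nat * int)) :
  (forall x, x \in w -> 0 < x.2) -> exists v, w = posz_exps v.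
Proof.
move=> w0; exists [seq (x.1, `|x.2|%N) | x <- w].
rewrite /posz_exps -map_comp -[LHS]map_id; apply/eq_in_map => -[k i] /w0 /= i0.
by rewrite gtz0_abs.
Qed.

Lemma unzip1_posz_exps w : unzip1 (posz_exps w) = unzip1 w.
Proof. by rewrite /unzip1 /posz_exps -map_comp. Qed.

Lemma sum_posz_exps w :
  \sum_(x <- posz_exps w) x.2 = (\sum_(x <- w) x.2)%N%:Z.
Proof. by rewrite big_map /= -natz natr_sum; apply: eq_bigr => x _; rewrite natz. Qed.

Lemma prod_posz_exps n w :
  (\prod_(x <- posz_exps w) expgz (tau n x.1) x.2 =
   \prod_(x <- w) tau n x.1 ^+ x.2)%g.
Proof. by rewrite big_map. Qed.

Lemma sorted_unzip1_lt k (T : Type) (i : T) (w : seq (nat * T)) :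
  sorted ltn (unzip1 ((k, i) :: w)) -> all (fun x => k < x.1)%N w.
Proof. by move/(order_path_min ltn_trans); rewrite all_map. Qed.

Theorem theorem3p0p8 (n : nat) (p : {perm (signed n)})
    (pS : p \in dotS n) (p_neq1 : p <> 1%g) :
  std_OGS_elementary (restr p) <->
  exists (k1 : nat) (i1 : int) (w : seq (nat * int)),
    [/\ gen_std_OGS p ((k1, i1) :: w),
        - k1%:Z <= i1 < 0,
        forall x, x \in w -> 0 < x.2 < x.1%:Z
      & i1 + \sum_(x <- w) x.2 = 0].
Proof.
split.
  case=> _ [k [i [w [[srt bnd rp] Sk]]]].
  set v := (k, i) :: w in srt bnd rp.
  pose S := (\sum_(x <- v) x.2)%N.
  have ES : S = (i + \sum_(x <- w) x.2)%N by rewrite /S big_cons.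
  have /allP ltk := sorted_unzip1_lt srt.
  have [/andP[k2 kn] /andP[i0 ik]] := bnd _ (mem_head _ _).
  rewrite /= in k2 kn i0 ik.
  have Sn : (S <= n)%N by rewrite ES; lia.
  have lev x : x \in v -> (S <= x.1 <= n)%N.
    move=> xv; have [/andP[_ ->] _] := bnd _ xv; rewrite andbT ES.
    move: xv; rewrite inE => /predU1P[->|/ltk]; first exact: Sk.
    by move=> /ltnW; apply: leq_trans.
  have pE := dotS_tau_lift pS Sn lev rp; rewrite -/S in pE.
  have pos_bnd u : {subset u <= v} ->
      forall x, x \in posz_exps u -> [/\ (1 <= x.1 <= n)%N, 0 < x.2 < x.1%:Z,
        - x.1%:Z <= x.2 < x.1%:Z & x.2 <> 0].
    move=> uv x /mapP[y /uv/bnd + ->] /=; case: y => a c /= [? ?]; split; lia.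
  (* If [S < k], the correction [tau n S ^- S] is a new first factor; if [S = k], it merges with the
     factor at [k]. *)
  have [ltSk|leSk] := ltnP S k.
    exists S, (- S%:Z), (posz_exps v); split.
    - split.
      + by rewrite -unzip1_posz_exps in srt; rewrite /= ltSk.
      + move=> x; rewrite inE => /predU1P[->|/(pos_bnd v (fun _ h => h))[]] //=; split; lia.
      + rewrite big_cons prod_posz_exps pE /=; congr (_ * _)%g.
        have -> : - S%:Z = Negz S.-1 by lia.
        rewrite /expgz prednK; last by lia.
        by rewrite tau_expNn // subnn expg0 mulg1.
    - lia.
    - by move=> x /(pos_bnd v (fun _ h => h))[].
    - by rewrite sum_posz_exps -/S addNr.
  have eSk : S = k by apply/eqP; rewrite eqn_leq leSk ES Sk.
  have wv : {subset w <= v} by move=> x xw; rewrite inE xw orbT.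
  (* [tau n k ^+ k] equals its own inverse, so multiplying by it lowers the exponent [i] by [k]. *)
  exists k, (i%:Z - k%:Z), (posz_exps w); split.
  - split.
    + by move: srt; rewrite /= unzip1_posz_exps.
    + move=> x; rewrite inE => /predU1P[->|/(pos_bnd w wv)[]] //=; split; lia.
    + rewrite big_cons prod_posz_exps pE /v big_cons /= eSk mulgA; congr (_ * _)%g.
      have -> : i%:Z - k%:Z = Negz (k - i).-1 by lia.
      rewrite /expgz prednK; last by lia.
      by rewrite tau_expNn ?leq_subr // subKn // ltnW.
  - lia.
  - by move=> x /(pos_bnd w wv)[].
  - rewrite sum_posz_exps; lia.
(* Only [Negz m], that is [-(m + 1)], is a negative exponent. *)
case=> k [[m|m] [w [[srt bnd pE] /andP[mk neg] wpos S0]]]; first by lia.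
have [v ?] : exists v, w = posz_exps v.
  by apply: posz_expsK => x /wpos /andP[].
subst w; rewrite sum_posz_exps in S0.
have [/andP[k1 kn] _ _] := bnd _ (mem_head _ _); rewrite /= in k1 kn.
have vbnd x : x \in v -> (2 <= x.1 <= n)%N /\ (0 < x.2 < x.1)%N.
  move=> xv; have xw : (x.1, x.2%:Z) \in posz_exps v by apply/mapP; exists x.
  have := wpos _ xw; have [] := bnd (x.1, x.2%:Z) _; first by rewrite inE xw orbT.
  case: x {xv xw} => a c /= [? ? ?] ?; split; lia.
have Sv : (\sum_(x <- v) x.2 = m.+1)%N by lia.
have mk' : (m.+1 <= k)%N by lia.
(* The exponent 0 is a placeholder: only the indices matter for sortedness. *)
have srtv : sorted ltn (unzip1 ((k, 0%N) :: v)).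
  by move: srt; rewrite /= unzip1_posz_exps.
have /allP ltk := sorted_unzip1_lt srtv.
rewrite big_cons prod_posz_exps -[expgz _ _]/(tau n k ^- m.+1)%g tau_expNn // -mulgA in pE.
split; first by move=> r1; apply/p_neq1/restr_dotS_inj.
(* If the first exponent is [-k], that factor is a pure sign change and dies under [restr]: the
   canonical form starts at the next index, which exceeds the exponent sum [k]. Otherwise [tcyc n k]
   keeps the exponent [k - m.+1], and the sum is exactly [k]. *)
have [ekm|nemk] := eqVneq m.+1 k.
  rewrite ekm subnn expg0 mul1g in pE.
  have rp := congr1 (@restr n) pE; rewrite restr_tau_lift // in rp.
  case: v rp Sv ltk vbnd srtv {srt bnd pE wpos S0} => [|[k2 i2] v] rp Sv ltk vbnd srtv.
    (* Some factor remains, since the exponents of [v] sum to [m.+1 > 0]. *)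
    by rewrite big_nil in Sv.
  exists k2, i2, v; split; last first.
    have := ltk _ (mem_head _ _); rewrite /= big_cons /= in Sv *; lia.
  split => //.
  by move: srtv => /= /andP[].
exists k, (k - m.+1)%N, v; split; last by rewrite Sv subnK.
split; first exact: srtv.
  move=> x; rewrite inE => /predU1P[->|/vbnd //] /=; lia.
rewrite -(restr_tau_lift _ kn) pE; congr (restr (_ * _)%g).
by rewrite big_cons.
Qed.
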